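(* Let $p$ be the minimum integer $n$ such that there exists a graph on $n$ vertices with odd girth $7$ and fractional chromatic number greater than $3+\frac{4}{n-1}$. Let $F$ be a graph with vertex set $V(F)=\{v_1,\dots,v_p\}$, odd girth $7$ and $\chi_f(F)>3+\frac{4}{p-1}$. Let $q\ge (p-1)/2$ be an integer, let $c=3q+2$, and let $G=F[K_q]$. Let $H$ be the graph with the following vertices and edges: (1) vertices $g_i$ for $i\in[c]$, forming a clique; (2) a vertex $\phi$, adjacent to $g_i$ for every $i\in[c]$ with $i>p$; (3) for each $i\in[p]$ and each $t\in[q+2,3q+2]$, a vertex $\mu_{i,t}$, where for each $i\in[p]$ the set $\{\mu_{i,t}: t\in[q+2,3q+2]\}\cup\{g_i\}$ forms a clique, and each vertex $\mu_{i,t}$ is further adjacent to every $g_j$ with $j\in[c]$, $j>2q+1$ and $j\ne t$; (4) for each $i\in[p]$ and each $t\in[2q+2,3q+2]$, a vertex $\theta_{i,t}$, adjacent to $\phi$, to $\mu_{i,t}$, and to every $g_j$ with $j\in[c]\setminus\{i,t\}$. (All these vertices are distinct, and $H$ has no other vertices or edges.) Then $$\chi(G)>c,\qquad \chi(H)>c,\qquad\text{and}\qquad \chi(G\times H)\le c.$$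
   Context: Graphs are finite and simple, and $\chi$ denotes the chromatic number. For a positive integer $c$, $[c]=\{1,2,\dots,c\}$, and for integers $a\le b$, $[a,b]=\{a,a+1,\dots,b\}$. The product $G\times H$ of graphs $G$ and $H$ has vertex set $V(G)\times V(H)$, with $(x,y)$ adjacent to $(x',y')$ if and only if $xx'\in E(G)$ and $yy'\in E(H)$. The lexicographic product $G[K_q]$ is the graph with vertex set $\{(x,i): x\in V(G), i\in[q]\}$ in which $(x,i)$ and $(y,j)$ are adjacent if and only if either $xy\in E(G)$, or $x=y$ and $i\neq j$. The fractional chromatic number of $G$ is $\chi_f(G)=\inf\{\chi(G[K_q])/q : q=1,2,\dots\}$. The odd girth of $G$ is the length of a shortest odd cycle in $G$. The existence of a graph of odd girth $7$ on some number $n$ of vertices with fractional chromatic number greater than $3+\frac{4}{n-1}$ (so that $p$ is well defined) is guaranteed by a classical result of Erdős. *)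

(* Defs.v *)
From HB Require Import structures.
From mathcomp Require Import all_boot all_order all_algebra.
From mathcomp Require Import classical_sets reals.
Set Implicit Arguments.
Unset Strict Implicit.
Unset Printing Implicit Defensive.
Import Order.TTheory GRing.Theory Num.Theory.

Record sgraph := SGraph {
  vertex :> finType;
  adj : rel vertex;
  adj_sym : symmetric adj;
  adj_irr : irreflexive adj
}.

Definition colorable (G : sgraph) (k : nat) : bool :=
  [exists f : {ffun G -> 'I_k},
     [forall x : G, forall y : G, adj x y ==> (f x != f y)]].

Lemma colorable_card (G : sgraph) : exists k, colorable G k.
Proof.
exists #|G|; apply/existsP; exists [ffun x => enum_rank x].
apply/forallP => x; apply/forallP => y; apply/implyP => xy.
rewrite !ffunE (inj_eq enum_rank_inj).
by apply: contraTneq xy => ->; rewrite adj_irr.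
Qed.

Definition chi (G : sgraph) : nat := ex_minn (colorable_card G).

Section Products.
Variables G H : sgraph.

Definition prod_adj : rel (G * H) :=
  fun u v => adj u.1 v.1 && adj u.2 v.2.

Lemma prod_adj_sym : symmetric prod_adj.
Proof. by move=> u v; rewrite /prod_adj !(adj_sym v.1, adj_sym v.2). Qed.

Lemma prod_adj_irr : irreflexive prod_adj.
Proof. by move=> u; rewrite /prod_adj adj_irr. Qed.

Definition gprod : sgraph := SGraph prod_adj_sym prod_adj_irr.

Variable q : nat.

Definition lexK_adj : rel (G * 'I_q) :=
  fun u v => adj u.1 v.1 || ((u.1 == v.1) && (u.2 != v.2)).

Lemma lexK_adj_sym : symmetric lexK_adj.
Proof. by move=> u v; rewrite /lexK_adj adj_sym !(eq_sym v.1, eq_sym v.2). Qed.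

Lemma lexK_adj_irr : irreflexive lexK_adj.
Proof. by move=> u; rewrite /lexK_adj adj_irr !eqxx. Qed.

(* The lexicographic product G[K_q]. *)
Definition lexK : sgraph := SGraph lexK_adj_sym lexK_adj_irr.

End Products.

Definition chi_f (R : realType) (G : sgraph) : R :=
  inf [set ((chi (lexK G q))%:R / q%:R)%R | q in [set q : nat | (0 < q)%N]]%classic.

Definition odd_cycle (G : sgraph) (s : seq G) : Prop :=
  [/\ ucycle (@adj G) s, 2 < size s & odd (size s)].

(* A relation rather than a function: a bipartite graph has no odd girth. *)
Definition has_odd_girth (G : sgraph) (g : nat) : Prop :=
  (exists2 s : seq G, odd_cycle s & size s = g) /\
  (forall s : seq G, odd_cycle s -> g <= size s).

Definition is_minimum (P : nat -> Prop) (n : nat) : Prop :=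
  P n /\ forall m, P m -> n <= m.

(* The odd girth forces n >= 7, so the denominator n - 1 is nonzero. *)
Definition large_chi_f (R : realType) (n : nat) (F : sgraph) : Prop :=
  [/\ #|F| = n, has_odd_girth F 7 &
      (3%:R + 4%:R / (n%:R - 1) < chi_f R F)%R].

(* The integer interval [a, b]. *)
Definition nint (a b : nat) := {t : 'I_b.+1 | a <= t}.
HB.instance Definition _ a b := Finite.on (nint a b).

Definition nint_val a b (t : nint a b) : nat := val t.
Coercion nint_val : nint >-> nat.

Section GraphH.
Variables p q : nat.
Local Notation c := (3 * q + 2).

Inductive Hvertex :=
  | Hg of nint 1 c
  | Hphi
  | Hmu of nint 1 p & nint (q + 2) c
  | Htheta of nint 1 p & nint (2 * q + 2) c.

Definition Hvertex_code (u : Hvertex) :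
    nint 1 c + unit + nint 1 p * nint (q + 2) c
    + nint 1 p * nint (2 * q + 2) c :=
  match u with
  | Hg i => inl (inl (inl i))
  | Hphi => inl (inl (inr tt))
  | Hmu i t => inl (inr (i, t))
  | Htheta i t => inr (i, t)
  end.

Definition Hvertex_decode
    (s : nint 1 c + unit + nint 1 p * nint (q + 2) c
         + nint 1 p * nint (2 * q + 2) c) : Hvertex :=
  match s with
  | inl (inl (inl i)) => Hg i
  | inl (inl (inr _)) => Hphi
  | inl (inr (i, t)) => Hmu i t
  | inr (i, t) => Htheta i t
  end.

Lemma Hvertex_codeK : cancel Hvertex_code Hvertex_decode.
Proof. by case. Qed.

HB.instance Definition _ := Equality.copy Hvertex (can_type Hvertex_codeK).
HB.instance Definition _ := Choice.copy Hvertex (can_type Hvertex_codeK).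
HB.instance Definition _ := Countable.copy Hvertex (can_type Hvertex_codeK).
HB.instance Definition _ : isFinite Hvertex := CanIsFinite Hvertex_codeK.

(* Each edge is listed in one direction at least; adjacency in H is the
   symmetric closure H_adj. *)
Definition H_arc (u v : Hvertex) : bool :=
  match u, v with
  | Hg i, Hg j => i != j :> nat
  | Hphi, Hg i => p < i
  | Hmu i t, Hmu i' t' => (i == i' :> nat) && (t != t' :> nat)
  | Hmu i t, Hg j => (j == i :> nat) || ((2 * q + 1 < j) && (j != t :> nat))
  | Htheta _ _, Hphi => true
  | Htheta i t, Hmu i' t' => (i == i' :> nat) && (t == t' :> nat)
  | Htheta i t, Hg j => (j != i :> nat) && (j != t :> nat)
  | _, _ => false
  end.

Definition H_adj : rel Hvertex := fun u v => H_arc u v || H_arc v u.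

Lemma H_adj_sym : symmetric H_adj.
Proof. by move=> u v; rewrite /H_adj orbC. Qed.

Lemma H_adj_irr : irreflexive H_adj.
Proof. by case=> [i||i t|i t] //; rewrite /H_adj /= ?eqxx ?andbF. Qed.

Definition graphH : sgraph := SGraph H_adj_sym H_adj_irr.

End GraphH.

(* Main.v *)
(* A c-colouring of G x H assigns to each vertex h of H a map V(G) -> [c] such
   that adjacent vertices h, h' receive maps m, m' with m x <> m' y for every
   edge xy of G.  Give g_i the constant map i and phi the map (v_i, a) |-> i.
   Since F has odd girth 7, the ball of radius 2 around v_i is bipartite, so
   2q colours other than i suffice for its blow-up; mu_{i,t} uses them there,
   independently of t, and is essentially constantly t at distance at least 3.
   The map theta_{i,t} is t on the closed neighbourhood of v_i and i elsewhere.
   In a c-colouring of H one may assume that g_i has colour i; phi then has a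
   colour i <= p <= 2q+1, by counting some mu_{i,t} has colour t >= 2q+2, and
   no colour is left for theta_{i,t}. *)
Require Import Defs.
From mathcomp Require Import all_boot all_order all_algebra.
From mathcomp Require Import classical_sets reals.
From mathcomp Require Import zify.
Set Implicit Arguments.
Unset Strict Implicit.
Unset Printing Implicit Defensive.
Import Order.TTheory GRing.Theory Num.Theory.

(** * Chromatic numbers and the lower bound for [G] *)

Lemma colorableP (G : sgraph) (k : nat) :
  reflect (exists f : G -> 'I_k, forall x y, adj x y -> f x != f y)
          (colorable G k).
Proof.
apply: (iffP existsP) => -[f fP].
  by exists f => x y; move/forallP/(_ x)/forallP/(_ y)/implyP: fP; apply.
exists (finfun f); apply/forallP => x; apply/forallP => y; apply/implyP.
by rewrite !ffunE; apply: fP.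
Qed.

Lemma chi_leP (G : sgraph) (k : nat) : reflect (colorable G k) (chi G <= k).
Proof.
rewrite /chi; case: ex_minnP => m mG m_min; apply: (iffP idP); last exact: m_min.
move=> mk; case/colorableP: mG => f fP.
by apply/colorableP; exists (fun x => widen_ord mk (f x)) => x y /fP.
Qed.

Lemma chi_le_nat (G : sgraph) (k : nat) (f : G -> nat) :
    (forall x, 0 < f x <= k) -> (forall x y, adj x y -> f x != f y) ->
  chi G <= k.
Proof.
move=> fk fP; apply/chi_leP/colorableP.
have lt_fk x : (f x).-1 < k by have := fk x; lia.
exists (fun x => Ordinal (lt_fk x)) => x y /fP.
by apply: contraNneq => /(congr1 val) /=; have := fk x; have := fk y; lia.
Qed.

Lemma chi_f_le (R : realType) (G : sgraph) (q : nat) :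
  0 < q -> (chi_f R G <= (chi (lexK G q))%:R / q%:R)%R.
Proof.
move=> q_gt0; apply: ge_inf; last by exists q.
by exists 0%R => _ [r _ <-]; rewrite divr_ge0.
Qed.

(** Multiplying by [q] gives more than [3q + 4q / (p - 1)], whose last term is at least 2. *)
Lemma chi_lexK_gt (R : realType) (G : sgraph) (p q : nat) :
    1 < p -> p - 1 <= 2 * q -> (3%:R + 4%:R / (p%:R - 1) < chi_f R G)%R ->
  3 * q + 2 < chi (lexK G q).
Proof.
move=> p_gt1 hq chiG; have q_gt0 : 0 < q by lia.
have := lt_le_trans chiG (chi_f_le R G q_gt0).
rewrite ltr_pdivlMr ?ltr0n // mulrDl -natrM -(ltr_nat R) natrD.
apply: le_lt_trans; rewrite lerD2l.
have p1_gt0 : (0 < p%:R - 1 :> R)%R by rewrite subr_gt0 ltr1n.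
rewrite mulrAC ler_pdivlMr // -(natrB _ (ltnW p_gt1)) -!natrM ler_nat; lia.
Qed.

(** * Balls of radius 2 without short odd cycles *)

Section Ball.
Variables (F : sgraph) (v : pred F).
Hypothesis v_inj : forall x y, v x -> v y -> x = y.
Hypothesis F_girth : forall s : seq F, odd_cycle s -> 7 <= size s.

Definition nbr (P : pred F) : pred F := fun y => [exists z : F, adj y z && P z].

Lemma nbr_adj (P : pred F) (x y : F) : adj x y -> P y -> nbr P x.
Proof. by move=> xy Py; apply/existsP; exists y; rewrite xy. Qed.

Lemma no_triangle (x y z : F) : adj x y -> adj y z -> adj z x -> False.
Proof.
move=> xy yz zx; suff /F_girth : odd_cycle [:: x; y; z] by [].
have neq (a b : F) : adj a b -> a != b by apply: contraTneq => ->; rewrite adj_irr.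
split=> //; rewrite /ucycle /= xy yz zx !inE.
by rewrite !negb_or (neq _ _ xy) (neq _ _ yz) eq_sym (neq _ _ zx).
Qed.

Lemma no_pentagon (x y z t u : F) :
  adj x y -> adj y z -> adj z t -> adj t u -> adj u x -> False.
Proof.
move=> xy yz zt tu ux; suff /F_girth : odd_cycle [:: x; y; z; t; u] by [].
have neq (a b : F) : adj a b -> a != b by apply: contraTneq => ->; rewrite adj_irr.
(* If [a = c], the triangle [a], [d], [e] remains; so a closed walk of length 5 has distinct
   vertices. *)
have chord (a b c d e : F) : adj a b -> adj b c -> adj c d -> adj d e -> adj e a ->
    a != c.
  move=> ab bc cd de ea; apply/eqP => ac.
  by subst c; apply: (@no_triangle a d e).
split=> //; rewrite /ucycle /= xy yz zt tu ux !inE !negb_or.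
rewrite (neq _ _ xy) (neq _ _ yz) (neq _ _ zt) (neq _ _ tu).
rewrite (eq_sym x u) (neq _ _ ux) (eq_sym x t) (eq_sym y u).
rewrite (chord x y z t u xy yz zt tu ux) (chord y z t u x yz zt tu ux xy).
rewrite (chord z t u x y zt tu ux xy yz) (chord t u x y z tu ux xy yz zt).
by rewrite (chord u x y z t ux xy yz zt tu).
Qed.

Lemma nbr_independent (x y : F) : adj x y -> nbr v x -> ~~ nbr v y.
Proof.
move=> xy /existsP[a /andP[xa va]]; apply/existsP => -[b /andP[yb vb]].
rewrite (v_inj vb va) in yb.
by apply: (@no_triangle x y a) => //; rewrite adj_sym.
Qed.

(** Otherwise the edge and two walks of length 2 to the centre close up to a walk of length 5. *)
Lemma nbr2_independent (x y : F) : adj x y -> nbr (nbr v) x -> ~~ nbr (nbr v) y.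
Proof.
move=> xy /existsP[a /andP[xa /existsP[b /andP[ab vb]]]].
apply/existsP => -[d /andP[yd /existsP[e /andP[de ve]]]].
rewrite (v_inj ve vb) in de.
by apply: (@no_pentagon x y d b a) => //; rewrite adj_sym.
Qed.

End Ball.

(* Three families of colours avoiding [i <= 2q+1]: [evencol i] and
   [oddcol q i] on ['I_q] enumerate disjoint q-subsets of [2q+1], and
   [farcol q i] on [q+2, 3q+2] avoids the first of them. *)
Definition evencol (i a : nat) : nat := if a.+1 < i then a.+1 else a.+2.
Definition oddcol (q i a : nat) : nat :=
  if q + 1 + a < i then q + 1 + a else q + 2 + a.
Definition farcol (q i t : nat) : nat := if t == i then q + 1 else t.

(** * The colouring of the product *)

Section Colouring.
Variables (p q : nat) (F : sgraph).
Hypothesis card_F : #|F| = p.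
Hypothesis le_pq : p <= 2 * q + 1.
Hypothesis F_girth : forall s : seq F, odd_cycle s -> 7 <= size s.

Definition idx (x : F) : nat := (enum_rank x).+1.
Definition is_idx (i : nat) : pred F := fun x => idx x == i.

Lemma is_idx_inj i x y : is_idx i x -> is_idx i y -> x = y.
Proof.
by move=> /eqP <- /eqP [] /val_inj /enum_rank_inj.
Qed.

Lemma idx_bounds x : 0 < idx x <= p.
Proof. by rewrite /idx -card_F ltn_ord. Qed.

Definition mucol (i t : nat) (u : lexK F q) : nat :=
  if nbr (is_idx i) u.1 then oddcol q i u.2
  else if is_idx i u.1 || nbr (nbr (is_idx i)) u.1 then evencol i u.2
  else farcol q i t.

Definition thetacol (i t : nat) (u : lexK F q) : nat :=
  if is_idx i u.1 || nbr (is_idx i) u.1 then t else i.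

Definition Hcol (u : lexK F q) (h : graphH p q) : nat :=
  match h with
  | Hg i => i
  | Hphi => idx u.1
  | Hmu i t => mucol i t u
  | Htheta i t => thetacol i t u
  end.

(** The last two clauses serve the edges from [Hmu i t] to the vertices [Hg j]: [j = i], and
    [j > 2q + 1] with [j != t]. *)
Lemma mucol_bounds i t u : 0 < i <= p -> q + 2 <= t <= 3 * q + 2 ->
  [/\ 0 < mucol i t u <= 3 * q + 2, mucol i t u != i &
      (mucol i t u <= 2 * q + 1) || (mucol i t u == t)].
Proof.
move=> hi ht; have := ltn_ord u.2; rewrite /mucol /evencol /oddcol /farcol.
by move=> ?; do ![case: ifP => ?]; split; lia.
Qed.

Lemma mucol_adj i t t' u w : 0 < i <= p -> q + 2 <= t -> q + 2 <= t' ->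
  t != t' -> adj u w -> mucol i t u != mucol i t' w.
Proof.
case: u w => [x a] [y b] hi ht ht' tt' /orP[/= xy|/andP[/= /eqP <- ab]]; last first.
  have ab' : a != b :> nat by [].
  have := ltn_ord a; have := ltn_ord b.
  rewrite /mucol /evencol /oddcol /farcol /=.
  by do ![case: ifP => ?]; lia.
have yx : adj y x by rewrite adj_sym.
have := ltn_ord a; have := ltn_ord b; rewrite /mucol /=.
have inj := @is_idx_inj i.
case n1x: (nbr (is_idx i) x); case n1y: (nbr (is_idx i) y).
- by have := nbr_independent inj F_girth xy n1x; rewrite n1y.
(* Only one end is a neighbour of the centre; the other gets [evencol], disjoint from [oddcol]. *)
- rewrite (nbr_adj yx n1x) orbT /evencol /oddcol.
  by do ![case: ifP => ?]; lia.
- rewrite (nbr_adj xy n1y) orbT /evencol /oddcol.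
  by do ![case: ifP => ?]; lia.
have n0y : is_idx i y = false by apply: contraFF n1x; apply: nbr_adj.
have n0x : is_idx i x = false by apply: contraFF n1y; apply: nbr_adj.
rewrite n0x n0y /=.
case n2x: (nbr (nbr _) x); case n2y: (nbr (nbr _) y).
- by have := nbr2_independent inj F_girth xy n2x; rewrite n2y.
(* The substitute [q + 1] in [farcol] occurs only for an index [i >= q + 2], and then [evencol]
   stays within [[1, q]]. *)
all: by rewrite /evencol /farcol; do ![case: ifP => ?]; lia.
Qed.

(** Where [thetacol] is [i], [mucol] avoids it; where it is [t], [w] lies in the ball of radius 2,
    on which [mucol] is at most [2q + 1]. *)
Lemma thetacol_mucol i t u w : 0 < i <= p -> 2 * q + 2 <= t <= 3 * q + 2 ->
  adj u w -> thetacol i t u != mucol i t w.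
Proof.
move=> hi ht uw.
have ht' : q + 2 <= t <= 3 * q + 2 by lia.
have [_ mu_neq _] := mucol_bounds w hi ht'.
rewrite /thetacol; case: ifP => [near|_]; last by rewrite eq_sym.
have near_w : [|| nbr (is_idx i) w.1, is_idx i w.1 | nbr (nbr (is_idx i)) w.1].
  case/orP: uw => [uw|/andP[/eqP <- _]]; last by rewrite orbCA orbA near.
  have wu : adj w.1 u.1 by rewrite adj_sym.
  by case/orP: near => /(nbr_adj wu) ->; rewrite ?orbT.
have := ltn_ord w.2; rewrite /mucol /evencol /oddcol.
case: ifP near_w => [_ _|_ /= ->]; case: ifP; lia.
Qed.

(** The value [t] exceeds [p]; the value [i] is taken only outside the closed neighbourhood of the
    vertex of index [i]. *)
Lemma thetacol_idx i t u w : 2 * q + 2 <= t ->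
  adj u w -> thetacol i t u != idx w.1.
Proof.
move=> ht uw; rewrite /thetacol; have := idx_bounds w.1.
case: ifPn => [_|near _]; first lia.
apply: contraNneq near => iw.
have n0w : is_idx i w.1 by rewrite /is_idx -iw.
case/orP: uw => [uw|/andP[/eqP -> _]]; last by rewrite n0w.
by rewrite (nbr_adj uw n0w) orbT.
Qed.

Lemma nint_bounds a b (t : nint a b) : a <= t <= b.
Proof. by rewrite (valP t) -ltnS ltn_ord. Qed.

Lemma Hcol_bounds u h : 0 < Hcol u h <= 3 * q + 2.
Proof.
case: h => [i||i t|i t] /=.
- exact: nint_bounds.
- by case/andP: (idx_bounds u.1) => _ /leq_trans -> //; lia.
- by have [] := mucol_bounds u (nint_bounds i) (nint_bounds t).
- have := nint_bounds i; have := nint_bounds t; rewrite /thetacol.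
  by case: ifP; lia.
Qed.

Lemma Hcol_arc u w h k : adj u w -> H_arc h k -> Hcol u h != Hcol w k.
Proof.
move=> uw; case: h k => [i||i t|i t] [j||j s|j s] //=.
- by apply: contraTneq => <-; rewrite -leqNgt; case/andP: (idx_bounds u.1).
- have [_] := mucol_bounds u (nint_bounds i) (nint_bounds t).
  by move=> mi mt /orP[/eqP -> //|]; lia.
- case/andP=> /eqP <-.
  have /andP[? _] := nint_bounds t; have /andP[? _] := nint_bounds s.
  by move=> ts; apply: mucol_adj => //; apply: nint_bounds.
- by rewrite /thetacol => ?; case: ifP; lia.
- by move=> _; apply: thetacol_idx => //; have := nint_bounds t; lia.
- by case/andP=> /eqP <- /eqP <-; apply: thetacol_mucol => //; apply: nint_bounds.
Qed.

Lemma chi_gprod_le : chi (gprod (lexK F q) (graphH p q)) <= 3 * q + 2.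
Proof.
pose GH := gprod (lexK F q) (graphH p q).
apply: (@chi_le_nat GH _ (fun uh => Hcol uh.1 uh.2)) => [[u h]|[u h] [w k]].
  exact: Hcol_bounds.
case/andP=> /= uw /orP[hk|kh]; first exact: Hcol_arc.
by rewrite eq_sym; apply: Hcol_arc; rewrite // adj_sym.
Qed.

End Colouring.

(** * The lower bound for [H] *)

Definition nint_of a b n (h : a <= n <= b) : nint a b :=
  let: conj han hnb := andP h in exist _ (Ordinal (hnb : n < b.+1)) han.

Lemma nint_ofE a b n (h : a <= n <= b) : nint_of h = n :> nat.
Proof. by rewrite /nint_of; case: (andP h). Qed.

Lemma chi_graphH_gt (p q : nat) : p <= 2 * q + 1 -> 3 * q + 2 < chi (graphH p q).
Proof.
move=> le_pq; rewrite ltnNge; apply/chi_leP => /colorableP[f fP].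
have arcP h k : H_arc h k -> f h != f k by move=> hk; apply/fP/orP; left.
have gP (i : 'I_(3 * q + 2)) : 1 <= i.+1 <= 3 * q + 2 by have := ltn_ord i; lia.
pose g i : graphH p q := Hg p (nint_of (gP i)).
have fg_inj : injective (f \o g).
  move=> i j /= /eqP; apply: contraTeq => ij; apply/arcP.
  by rewrite /= !nint_ofE eqSS.
(* The clique uses every colour once, so a colour is named by the zero-based index of its clique
   vertex. *)
pose gcol := invF fg_inj.
have gcolK s : f (g (gcol s)) = s by exact: (f_invF fg_inj).
set phi := Hphi p q; pose i := gcol (f phi).
have lt_ip : i < p.
  rewrite ltnNge; apply/negP => p_i.
  have /arcP : H_arc phi (g i) by rewrite /= nint_ofE ltnS.
  by rewrite gcolK eqxx.
have iP : 1 <= i.+1 <= p by [].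
have tP (t : 'I_(2 * q + 1)) : q + 2 <= t + (q + 2) <= 3 * q + 2.
  by have := ltn_ord t; lia.
pose mu t : graphH p q := Hmu (nint_of iP) (nint_of (tP t)).
have fmu_inj : injective (f \o mu).
  move=> t t' /= /eqP; apply: contraTeq => tt'; apply/arcP.
  by rewrite /= !nint_ofE eqxx eqn_add2r.
have mu_col t (j := gcol (f (mu t))) :
    j != i :> nat /\ (j < 2 * q + 1 \/ j.+1 = t + (q + 2)).
  have: ~~ H_arc (mu t) (g j) by apply/negP => /arcP; rewrite gcolK eqxx.
  by rewrite /= !nint_ofE; lia.
(* Otherwise the [2q + 1] vertices [mu t] take all low colours, including the colour [i], which they
   cannot have. *)
have [t t_hi] : exists t, 2 * q + 1 <= gcol (f (mu t)).
  apply/existsP; apply: contraT => /existsPn lo.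
  have low t : gcol (f (mu t)) < 2 * q + 1 by rewrite ltnNge lo.
  have low_inj : injective (fun t => Ordinal (low t)).
    move=> t t' /(congr1 val) /= /val_inj tt'; apply: fmu_inj => /=.
    by rewrite -[LHS]gcolK tt' gcolK.
  have lt_iq : i < 2 * q + 1 by lia.
  have /codomP[t /(congr1 val) /= it] := injF_onto low_inj (Ordinal lt_iq).
  by have [] := mu_col t; rewrite -it eqxx.
have [_ t_col] := mu_col t.
have thP : 2 * q + 2 <= t + (q + 2) <= 3 * q + 2 by have := tP t; lia.
pose theta : graphH p q := Htheta (nint_of iP) (nint_of thP).
(* The clique leaves [theta] two colours, one taken by [phi] and the other by [mu t]. *)
have: ~~ H_arc theta (g (gcol (f theta))).
  by apply/negP => /arcP; rewrite gcolK eqxx.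
rewrite /= !nint_ofE negb_and !negbK eqSS => /orP[/eqP th_i|/eqP th_t].
  have /arcP/eqP[] : H_arc theta phi by [].
  by rewrite -[LHS]gcolK (val_inj th_i) gcolK.
have /arcP/eqP[] : H_arc theta (mu t) by rewrite /= !nint_ofE !eqxx.
have /val_inj th_mu : gcol (f theta) = gcol (f (mu t)) :> nat by lia.
by rewrite -[LHS]gcolK th_mu gcolK.
Qed.

Theorem theorem3 (R : realType) (p : nat)
    (hp : is_minimum (fun n => exists F' : sgraph, large_chi_f R n F') p)
    (F : sgraph) (hF : large_chi_f R p F)
    (q : nat) (hq : (p - 1 <= 2 * q)%N) :
  let c := (3 * q + 2)%N in
  let G := lexK F q in
  let H := graphH p q in
  [/\ (c < chi G)%N, (c < chi H)%N & (chi (gprod G H) <= c)%N].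
Proof.
case: hF => card_F [[s [/andP[_ s_uniq] _ _] s7] F_girth] chiF /=.
(* The 7-cycle has distinct vertices. *)
have p_ge7 : 7 <= p by rewrite -card_F -s7 -(card_uniqP s_uniq) max_card.
have le_pq : p <= 2 * q + 1 by lia.
split; first by apply: chi_lexK_gt chiF => //; lia.
  exact: chi_graphH_gt.
exact: chi_gprod_le.
Qed.
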